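(* Let $U\subset\mathbb{R}$ be an interval, let $\phi,K,\delta>0$, and let $f,g\in\mathcal{S}(U)$ be $(\phi,K,\delta)$-separated. Then $$\rho(A^{[f]},A^{[g]})\ge \frac1K \ln(1+K\alpha),$$ where $$\alpha:= \frac{e^{-K\phi/2}-1}{K}-\frac{e^{(\delta-K)\phi/2}-1}{K-\delta}$$ (if $\delta=K$, the second fraction is understood as its limit value $-\phi/2$ as $\delta \to K$, i.e. $\alpha=\frac{e^{-K\phi/2}-1}{K}+\frac{\phi}{2}$).
   Context: Intervals are nondegenerate and $|V|$ denotes the length of an interval $V$. Quasi-arithmetic means: for a continuous, strictly monotone $f\colon U\to\mathbb{R}$, a tuple $a=(a_1,\dots,a_n)\in U^n$ ($n\in\mathbb{N}$) and weights $w=(w_1,\dots,w_n)$ with $w_i>0$, $\sum_i w_i=1$, put $A^{[f]}(a,w):=f^{-1}\left(\sum_{i=1}^n w_i f(a_i)\right)$. For two such functions $f,g$ on the same $U$, $\rho(A^{[f]},A^{[g]}):=\sup |A^{[f]}(a,w)-A^{[g]}(a,w)|\in[0,\infty]$, where the supremum is over all $n$, all $a\in U^n$ and all such weights $w$ of length $n$. $\mathcal{S}(U)$ is the set of twice differentiable functions $f\colon U\to\mathbb{R}$ with nowhere vanishing first derivative; for $f\in\mathcal{S}(U)$, $P_f:=f''/f'$. Functions $f,g\in\mathcal{S}(U)$ are called $(\phi,K,\delta)$-separated if there exists a closed interval $V\subset U$ with $|V|=\phi$ such that for all $x\in V$: $|P_f(x)|\le K$, $|P_g(x)|\le K$ and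 $|P_f(x)-P_g(x)|\ge\delta$. *)

(* Defs.v *)
From HB Require Import structures.
From mathcomp Require Import all_boot all_order all_algebra.
From mathcomp Require Import all_classical all_reals all_analysis.

Set Implicit Arguments.
Unset Strict Implicit.
Unset Printing Implicit Defensive.

Import Order.TTheory GRing.Theory Num.Theory.
Import numFieldNormedType.Exports.

Local Open Scope classical_set_scope.
Local Open Scope ring_scope.

(** A function U -> R is represented by a total f : R -> R; the definitions
    below only depend on the restriction of f to U. *)

Definition nondegenerate_interval (R : realType) (U : set R) : Prop :=
  is_interval U /\ exists x y, [/\ U x, U y & x < y].

(** The derivative of f : U -> R is the limit of the difference quotient within
    U: it is one-sided at an endpoint of U that belongs to U, and it is the
    usual derivative at an interior point. *)
Definition derivable_on (R : realType) (U : set R) (f : R -> R) : Prop :=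
  forall x, U x -> cvg ((f y - f x) / (y - x) @[y --> within U x^']).

Definition derive_on (R : realType) (U : set R) (f : R -> R) (x : R) : R :=
  lim ((f y - f x) / (y - x) @[y --> within U x^']).

Definition classS (R : realType) (U : set R) : set (R -> R) :=
  [set f | [/\ derivable_on U f,
               derivable_on U (derive_on U f) &
               forall x, U x -> derive_on U f x != 0]].

Definition Pop (R : realType) (U : set R) (f : R -> R) (x : R) : R :=
  derive_on U (derive_on U f) x / derive_on U f x.

(** [pinv U f] is the inverse of f : U -> f @` U when f is injective on U. *)
Definition qamean (R : realType) (U : set R) (f : R -> R) (n : nat)
    (a w : 'I_n -> R) : R :=
  pinv U f (\sum_(i < n) w i * f (a i)).

(** [n] is positive as the weights sum to 1. *)
Definition qadist (R : realType) (U : set R) (f g : R -> R) : \bar R :=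
  ereal_sup [set d : \bar R | exists (n : nat) (a w : 'I_n -> R),
    [/\ forall i, U (a i),
        forall i, 0 < w i,
        \sum_(i < n) w i = 1 &
        d = `|qamean U f a w - qamean U g a w|%:E]].

Definition P_separated (R : realType) (U : set R) (phi K delta : R)
    (f g : R -> R) : Prop :=
  exists a b : R,
    [/\ a < b, b - a = phi, `[a, b] `<=` U &
        forall x, x \in `[a, b] ->
          [/\ `|Pop U f x| <= K, `|Pop U g x| <= K &
              delta <= `|Pop U f x - Pop U g x| ]].

(** The value at [delta = K] is the limit of the second fraction. *)
Definition alpha (R : realType) (phi K delta : R) : R :=
  (expR (- K * phi / 2) - 1) / K -
  (if delta == K then - phi / 2
   else (expR ((delta - K) * phi / 2) - 1) / (K - delta)).

(* Main.v *)
Require Import Defs.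
From HB Require Import structures.
From mathcomp Require Import all_boot all_order all_algebra.
From mathcomp Require Import all_classical all_reals all_analysis.
From mathcomp Require Import ring lra.

Set Implicit Arguments.
Unset Strict Implicit.
Unset Printing Implicit Defensive.

Import Order.TTheory GRing.Theory Num.Theory.
Import numFieldNormedType.Exports.

Local Open Scope classical_set_scope.
Local Open Scope ring_scope.

(** Let [c] be the midpoint of the interval of separation and [h = phi / 2].
    Quasi-arithmetic means do not change when [f] is replaced by [k * f + m]
    with [k <> 0], so one may assume [f c = 0] and [f' c = 1].  Then
    [f' = expR L] where [L c = 0] and [L' = P_f], and likewise for [g]
    ([normalized_form]).

    The difference [P_f - P_g] is a derivative that never vanishes, so it has a
    constant sign ([derive_neq0_constant_sign]); the distance being symmetric,
    one may assume [delta <= P_f - P_g].  With [s = |x - c|] this gives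
    [f' / g' >= expR (delta * s)] to the right of [c] and the opposite
    [g' / f' >= expR (delta * s)] to its left, while all of [f'], [g'] lie
    between [expR (- K * s)] and [expR (K * s)].  Hence [f - g] grows away from
    [c], in both directions, at a rate at least
    [expR (- K * s) * (expR (delta * s) - 1)], whose integral over [[0, h]] is
    exactly [alpha phi K delta] ([is_derive_alpha]).  So [f - g >= alpha] at
    both ends of the interval.

    Now weigh the two endpoints so that their [g]-mean is [c].  The weighted
    value of [g] is [0], so that of [f] is at least [alpha]; the [f]-mean [z]
    of the endpoints therefore satisfies [alpha <= f z].  Since
    [f z <= (expR (K * (z - c)) - 1) / K], solving for [z - c] gives the bound
    ([two_point_gap]).  Integrals are avoided throughout: an inequality between
    integrals becomes a comparison of derivatives by the mean value theorem
    ([le_derive_increment]). *)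

(** * Derivatives within an interval *)

(** Near an interior point [x] of [U], [within U x^'] is just [x^'], so that the
    derivative within [U] is the usual one. *)
Lemma is_derive_derive_on (R : realType) (U : set R) (f : R -> R) (x : R) :
  derivable_on U f -> U° x -> is_derive x 1 f (derive_on U f x).
Proof.
move=> fU Ux.
have Ex : within U x^' = x^'.
  rewrite /dnbhs; apply/seteqP; split => A; rewrite /within /=; last first.
    by apply: filterS => y Ay yx _; exact: Ay.
  by apply: filterS2 Ux => y Uy Ay yx; exact: Ay.
have /= cvf := fU x (interior_subset Ux).
have shx : (shift x : R -> R) h @[h --> 0^'] --> x^'.
  have := @continuous_injective_withinNx _ _ (shift x : R -> R) 0.
  rewrite /= add0r; apply; last by move=> y; rewrite -[RHS]add0r => /addIr.
  by apply: cvgD; [exact: cvg_id|exact: cvg_cst].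
have key : (fun h : R => h^-1 *: ((f \o shift x) (h *: 1) - f x)) @ 0^' -->
    derive_on U f x.
  have -> : (fun h : R => h^-1 *: ((f \o shift x) (h *: 1) - f x)) =
      (fun y => (f y - f x) / (y - x)) \o shift x.
    by apply/funext => h /=; rewrite addrK [h *: 1]mulr1 mulrC.
  apply: cvg_trans (cvf); rewrite Ex; exact: cvg_app shx.
by apply: DeriveDef; [apply: cvgP key | exact: cvg_lim key].
Qed.

(** This also covers the endpoints of [U] that belong to [U], where [f] need not
    be differentiable as a function on the whole line. *)
Lemma derivable_on_within_continuous (R : realType) (U : set R) (f : R -> R) :
  derivable_on U f -> {within U, continuous f}.
Proof.
move=> fU; apply/subspace_continuousP => x Ux.
have FU : Filter (within U x^') by apply: within_filter; exact: within_filter.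
have cvf := fU x Ux.
have cvx : (y - x) @[y --> within U x^'] --> (0 : R).
  rewrite -(subrr x).
  do 2 apply: cvg_within_filter.
  by apply: cvgB; [exact: cvg_id|exact: cvg_cst].
have cv : f x + (f y - f x) / (y - x) * (y - x) @[y --> within U x^'] --> f x.
  by have := cvgD (cvg_cst (f x)) (cvgM cvf cvx); rewrite mulr0 addr0; apply.
move=> A fA.
have : \forall y \near x, y != x -> U y -> A (f y).
  have : \forall y \near x, y != x -> U y ->
      A (f x + (f y - f x) / (y - x) * (y - x)) := cv A fA.
  apply: filterS => y + yx Uy => /(_ yx Uy).
  by rewrite divfK ?subr_eq0// addrC subrK.
apply: filterS => y H Uy; have [->|yx] := eqVneq y x; last exact: H.
exact: (@nbhs_singleton R (f x)).
Qed.

(** * Consequences of the mean value theorem *)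

Lemma ge_derive_increment (R : realType) (f df : R -> R) (m x y : R) :
  x <= y -> {within `[x, y], continuous f} ->
  (forall t, t \in `]x, y[ -> is_derive t 1 f (df t)) ->
  (forall t, t \in `]x, y[ -> m <= df t) ->
  m * (y - x) <= f y - f x.
Proof.
rewrite le_eqVlt => /predU1P[->|xy] cf f' df_ge; first by rewrite !subrr mulr0.
have [t txy ->] := MVT xy f' cf.
by rewrite ler_wpM2r ?df_ge// subr_ge0 ltW.
Qed.

(** Replaces the integration of the inequality [df <= dg] from [x] to [y]. *)
Lemma le_derive_increment (R : realType) (f g df dg : R -> R) (x y : R) :
  x <= y ->
  {within `[x, y], continuous f} -> {within `[x, y], continuous g} ->
  (forall t, t \in `]x, y[ -> is_derive t 1 f (df t)) ->
  (forall t, t \in `]x, y[ -> is_derive t 1 g (dg t)) ->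
  (forall t, t \in `]x, y[ -> df t <= dg t) ->
  f y - f x <= g y - g x.
Proof.
move=> xy cf cg f' g' fg.
have gf' t (txy : t \in `]x, y[) : is_derive t 1 (g - f) (dg t - df t) :=
  is_deriveB (g' t txy) (f' t txy).
have := ge_derive_increment (m := 0) xy (within_continuousB cg cf) gf'.
rewrite mul0r !fctE => incr.
have : 0 <= g y - f y - (g x - f x).
  by apply: incr => t txy; rewrite subr_ge0 fg.
lra.
Qed.

Lemma derive_gt0_lt (R : realType) (f df : R -> R) (x y : R) :
  x < y -> {within `[x, y], continuous f} ->
  (forall t, t \in `]x, y[ -> is_derive t 1 f (df t)) ->
  (forall t, t \in `]x, y[ -> 0 < df t) ->
  f x < f y.
Proof.
move=> xy cf f' df0; have [t txy E] := MVT xy f' cf.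
by rewrite -subr_gt0 E mulr_gt0 ?df0// subr_gt0.
Qed.

Lemma derive_neq0_neq (R : realType) (f df : R -> R) (x y : R) :
  x < y -> {within `[x, y], continuous f} ->
  (forall t, t \in `]x, y[ -> is_derive t 1 f (df t)) ->
  (forall t, t \in `]x, y[ -> df t != 0) ->
  f x != f y.
Proof.
move=> xy cf f' df0; have [t txy E] := MVT xy f' cf.
by rewrite eq_sym -subr_eq0 E mulf_neq0 ?df0// subr_eq0 gt_eqF.
Qed.

Lemma in_itvoo_segment (R : realType) (a b x y t : R) :
  x \in `]a, b[ -> y \in `]a, b[ -> t \in `[x, y] -> t \in `]a, b[.
Proof.
rewrite !in_itv/= => /andP[ax _] /andP[_ yb] /andP[xt ty].
by rewrite (lt_le_trans ax xt) (le_lt_trans ty yb).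
Qed.

Lemma is_derive_within_continuous (R : realType) (f df : R -> R) (a b x y : R) :
  (forall t, t \in `]a, b[ -> is_derive t 1 f (df t)) ->
  x \in `]a, b[ -> y \in `]a, b[ -> {within `[x, y], continuous f}.
Proof.
move=> f' xab yab; apply: derivable_within_continuous => t txy.
have tab := in_itvoo_segment xab yab txy.
by have := f' t tab => -[].
Qed.

(** Darboux: [df] need not be continuous, but by the mean value theorem [f] is
    injective on the interval; being continuous there, it is monotone, which
    fixes the sign of its derivative. *)
Lemma derive_neq0_constant_sign (R : realType) (f df : R -> R) (a b : R) :
  (forall t, t \in `]a, b[ -> is_derive t 1 f (df t)) ->
  (forall t, t \in `]a, b[ -> df t != 0) ->
  (forall t, t \in `]a, b[ -> 0 < df t) \/
  (forall t, t \in `]a, b[ -> df t < 0).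
Proof.
move=> f' df0.
have drv t : t \in `]a, b[ -> derivable f t 1 by move=> /f'[].
have cf : {within `]a, b[, continuous f} by apply: derivable_within_continuous.
have dE t : t \in `]a, b[ -> f^`()%classic t = df t.
  by move=> /f'[_ <-]; rewrite derive1E.
have neq x y : x \in `]a, b[ -> y \in `]a, b[ -> x < y -> f x != f y.
  move=> xab yab xy.
  have sub t : t \in `]x, y[ -> t \in `]a, b[.
    by move=> /subset_itv_oo_cc; exact: in_itvoo_segment.
  have cxy := is_derive_within_continuous f' xab yab.
  exact: (derive_neq0_neq xy cxy (fun t txy => f' t (sub t txy))
    (fun t txy => df0 t (sub t txy))).
have injf : {in `]a, b[ &, injective f}.
  move=> x y xab yab fxy; apply/eqP; case: ltgtP => // xy.
  - by have := neq _ _ xab yab xy; rewrite fxy eqxx.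
  - by have := neq _ _ yab xab xy; rewrite fxy eqxx.
have [incf|decf] := itv_continuous_inj_mono cf injf; [left|right] => t tab.
  rewrite lt_neqAle eq_sym df0// -dE//.
  apply: (incr_derive1_ge0_itv _ incf tab) => u; rewrite inE; exact: drv.
rewrite lt_neqAle df0// -dE//.
apply: (decr_derive1_le0_itv _ decf tab) => u; rewrite inE; exact: drv.
Qed.

Lemma is_derive_subr (R : realType) (f : R -> R) (c t d : R) :
  is_derive (t - c) 1 f d -> is_derive t 1 (fun x => f (x - c)) d.
Proof.
move=> f'; have E : is_derive t 1 (fun x => f (x - c)) (d * 1).
  exact: (@is_derive1_comp _ f (shift (- c)) _ _ _ f' (is_derive_shift t 1 _)).
by rewrite mulr1 in E.
Qed.

Lemma is_derive_rsub (R : realType) (f : R -> R) (c t d : R) :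
  is_derive (c - t) 1 f d -> is_derive t 1 (fun x => - f (c - x)) d.
Proof.
move=> f'.
have E : is_derive t 1 (fun x : R => c - x) (0 - 1 : R).
  exact: is_deriveB (is_derive_cst c t 1) (is_derive_id t 1).
have := is_deriveN (@is_derive1_comp _ f (fun x => c - x) _ _ _ f' E).
by rewrite sub0r mulrN1 opprK.
Qed.

(** * Twice differentiable functions with nonvanishing derivative *)

Lemma classS_inj (R : realType) (U : set R) (f : R -> R) :
  is_interval U -> classS U f -> {in U &, injective f}.
Proof.
move=> iU [fU _ f0].
have cf := derivable_on_within_continuous fU.
have neq x y : U x -> U y -> x < y -> f x != f y.
  move=> Ux Uy xy.
  have sU : `[x, y] `<=` U.
    by move=> t /=; rewrite in_itv/=; exact: iU.
  have sI t : t \in `]x, y[ -> U° t.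
    by move=> txy; apply: (interiorS sU); rewrite interior_itv.
  have f' t (txy : t \in `]x, y[) := is_derive_derive_on fU (sI t txy).
  apply: (derive_neq0_neq xy _ f'); first exact: continuous_subspaceW sU cf.
  by move=> t /sI/interior_subset; exact: f0.
move=> x y; rewrite !inE => Ux Uy fxy; apply/eqP; case: ltgtP => // xy.
- by have := neq _ _ Ux Uy xy; rewrite fxy eqxx.
- by have := neq _ _ Uy Ux xy; rewrite fxy eqxx.
Qed.

(** Means only see [f] up to an affine change of its values, and the logarithm
    [L = ln (f' / f' c)] is defined because [f'] has a constant sign on the
    interval; its derivative is [Pop U f], so that bounds on [Pop] become linear
    bounds on [L]. *)
Lemma normalized_form (R : realType) (U : set R) (f : R -> R) (a b c : R) :
  classS U f -> `[a, b] `<=` U -> c \in `]a, b[ ->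
  exists (k : R) (h L : R -> R),
    [/\ k != 0, forall x, f x = k * h x + f c,
        {within `[a, b], continuous h},
        h c = 0 /\ L c = 0 &
        forall x, x \in `]a, b[ ->
          is_derive x 1 h (expR (L x)) /\ is_derive x 1 L (Pop U f x)].
Proof.
move=> [fU f'U f0] abU cab; set F := derive_on U f.
have sI t : t \in `]a, b[ -> U° t.
  by move=> tab; apply: (interiorS abU); rewrite interior_itv.
have f' t (tab : t \in `]a, b[) : is_derive t 1 f (F t).
  exact: is_derive_derive_on fU (sI t tab).
have F' t (tab : t \in `]a, b[) : is_derive t 1 F (derive_on U F t).
  exact: is_derive_derive_on f'U (sI t tab).
have F0 t : t \in `]a, b[ -> F t != 0.
  by move=> /sI/interior_subset; exact: f0.
have Fc0 : F c != 0 by exact: F0.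
have quot_gt0 t : t \in `]a, b[ -> 0 < F t / F c.
  move=> tab; have [Fpos|Fneg] := derive_neq0_constant_sign f' F0.
    by rewrite divr_gt0 ?Fpos.
  by rewrite nmulr_lgt0 ?Fneg// invr_lt0 Fneg.
have divE (u : R -> R) : (fun y => u y / F c) = (F c)^-1 *: u.
  by apply/funext => y; rewrite mulrC.
exists (F c), (fun x => (f x - f c) / F c), (fun x => ln (F x / F c)); split.
- exact: Fc0.
- by move=> x; rewrite mulrC divfK// subrK.
- rewrite divE => x; apply: continuousZr; apply: continuousB;
    last exact: cst_continuous.
  exact: (continuous_subspaceW abU (derivable_on_within_continuous fU)).
- by rewrite subrr mul0r divff ?ln1.
- move=> x xab; split.
    rewrite lnK ?posrE ?quot_gt0// (divE (fun x => f x - f c)).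
    have Dfc : is_derive x 1 (f - cst (f c)) (F x - 0).
      exact: is_deriveB (f' x xab) (is_derive_cst _ _ _).
    apply: (is_derive_eq (is_deriveZ (F c)^-1 Dfc)).
    by rewrite subr0 mulrC.
  have quot' : is_derive x 1 (fun y => F y / F c) ((F c)^-1 *: derive_on U F x).
    by rewrite divE; exact: is_deriveZ (F' x xab).
  have ln' : is_derive x 1 (fun y => ln (F y / F c))
      ((F x / F c)^-1 * ((F c)^-1 *: derive_on U F x)).
    exact: (@is_derive1_comp _ (@ln R) (fun y => F y / F c) _ _ _
      (is_derive1_ln (quot_gt0 x xab)) quot').
  apply: (is_derive_eq ln').
  rewrite /Pop -/F; have := F0 _ xab => ?.
  by rewrite /GRing.scale/=; field; apply/andP.
Qed.

(** * The quantity alpha *)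

Lemma is_derive_expRZ (R : realType) (k t : R) :
  is_derive t 1 (fun s => expR (k * s)) (k * expR (k * t)).
Proof.
have lin : is_derive t 1 (fun s : R => k * s) (k *: (1 : R)) :=
  is_deriveZ k (is_derive_id t 1).
have E : is_derive t 1 (fun s => expR (k * s)) (expR (k * t) * (k *: (1 : R))).
  exact: (@is_derive1_comp _ (@expR R) (fun s => k * s) _ _ _
    (is_derive_expR (k * t)) lin).
by apply: (is_derive_eq E); rewrite mulrC [k *: 1]mulr1.
Qed.

Lemma is_derive_expR_quot (R : realType) (k t : R) : k != 0 ->
  is_derive t 1 (fun s => (expR (k * s) - 1) / k) (expR (k * t)).
Proof.
move=> k0.
have E : is_derive t 1 (k^-1 \*: ((fun s => expR (k * s)) - cst 1))
    (k^-1 *: (k * expR (k * t) - 0)).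
  exact: is_deriveZ (is_deriveB (is_derive_expRZ k t) (is_derive_cst _ _ _)).
rewrite (_ : (fun s => _) = k^-1 \*: ((fun s => expR (k * s)) - cst 1)).
  by apply: (is_derive_eq E); rewrite subr0 [_ *: _]mulrA mulVf// mul1r.
by apply/funext => s; rewrite mulrC.
Qed.

(** In terms of the half-length [s = phi / 2], [alpha] is the primitive
    vanishing at [0] of [expR (- K * s) * (expR (delta * s) - 1)]; the value
    chosen at [delta = K] is the one for which this remains true. *)
Lemma is_derive_alpha (R : realType) (K delta t : R) : K != 0 ->
  is_derive t 1 (fun s => alpha (2 * s) K delta)
    (expR ((delta - K) * t) - expR (- K * t)).
Proof.
move=> K0; have NK0 : - K != 0 by rewrite oppr_eq0.
have EK := is_derive_expR_quot t NK0.
have [->|dK] := eqVneq delta K.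
  rewrite (_ : (fun s => _) =
      idfun - (fun s => (expR (- K * s) - 1) / (- K))); last first.
    apply/funext => s; rewrite !fctE /idfun /alpha eqxx.
    have -> : - K * (2 * s) / 2 = - K * s by field.
    by rewrite invrN; field.
  by rewrite subrr mul0r expR0; exact: is_deriveB (is_derive_id _ _) EK.
have dK0 : delta - K != 0 by rewrite subr_eq0.
rewrite (_ : (fun s => _) =
    (fun s => (expR ((delta - K) * s) - 1) / (delta - K))
    - (fun s => (expR (- K * s) - 1) / (- K))); last first.
  apply/funext => s; rewrite !fctE /alpha (negbTE dK).
  have -> : - K * (2 * s) / 2 = - K * s by field.
  have -> : (delta - K) * (2 * s) / 2 = (delta - K) * s by field.
  by field; rewrite K0 dK0 -opprB oppr_eq0.
exact: is_deriveB (is_derive_expR_quot t dK0) EK.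
Qed.

Lemma alpha0 (R : realType) (K delta : R) : alpha 0 K delta = 0.
Proof.
rewrite /alpha !mulr0 oppr0 !mul0r expR0 subrr !mul0r.
by case: ifP; rewrite subrr.
Qed.

(** The pointwise bound on [|f' - g'|], with [expR M] the larger of the two
    derivatives and [expR N] the smaller: only a lower bound on the smaller one
    and a lower bound on their ratio are used. *)
Lemma ler_expR_gap (R : realType) (K delta M N t : R) : 0 <= delta -> 0 <= t ->
  - K * t <= N -> delta * t <= M - N ->
  expR ((delta - K) * t) - expR (- K * t) <= expR M - expR N.
Proof.
move=> d0 t0 HN HM.
have -> : expR ((delta - K) * t) = expR (delta * t) * expR (- K * t).
  by rewrite -expRD -mulrDl.
have -> : expR M = expR (M - N) * expR N by rewrite -expRD subrK.
have e1 : 1 <= expR (delta * t).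
  by rewrite -expR0 ler_expR mulr_ge0.
have e2 : expR (delta * t) <= expR (M - N) by rewrite ler_expR.
have e3 : expR (- K * t) <= expR N by rewrite ler_expR.
have e4 := expR_ge0 (- K * t).
rewrite -[X in _ - X <= _]mul1r -[X in _ <= _ - X]mul1r -!mulrBl.
by apply: ler_pM; rewrite ?subr_ge0 ?lerD2r.
Qed.

Lemma alpha_ge0 (R : realType) (K delta t : R) :
  0 < K -> 0 <= delta -> 0 <= t ->
  0 <= alpha (2 * t) K delta.
Proof.
move=> K0 d0 t0; have Kn0 := lt0r_neq0 K0.
have A' s (st : s \in `]0, t[) := is_derive_alpha delta s Kn0.
have cA : {within `[0, t], continuous (fun s => alpha (2 * s) K delta)}.
  apply: derivable_within_continuous => s _.
  by have [] := is_derive_alpha delta s Kn0.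
have : 0 * (t - 0) <= alpha (2 * t) K delta - alpha (2 * 0) K delta.
  apply: (ge_derive_increment t0 cA A') => s; rewrite in_itv/= => /andP[s0 _].
  by rewrite subr_ge0 ler_expR ler_wpM2r ?(ltW s0)//; lra.
by rewrite mulr0 alpha0 !subr0 mul0r.
Qed.

(** * The two-point estimate *)

(** The equality for [g] says that the [g]-mean of [c - h] and [c + h] with
    weights [w] and [1 - w] is [c], and the one for [f] that their [f]-mean
    is [z]. *)
Lemma two_point_gap (R : realType) (K delta c h : R)
    (f g Lf Lg Pf Pg : R -> R) :
  0 < h -> 0 < K -> 0 < delta ->
  {within `[c - h, c + h], continuous f} ->
  {within `[c - h, c + h], continuous g} ->
  f c = 0 -> g c = 0 -> Lf c = 0 -> Lg c = 0 ->
  (forall x : R, x \in `]c - h, c + h[ ->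
    is_derive x 1 f (expR (Lf x)) /\ is_derive x 1 Lf (Pf x)) ->
  (forall x : R, x \in `]c - h, c + h[ ->
    is_derive x 1 g (expR (Lg x)) /\ is_derive x 1 Lg (Pg x)) ->
  (forall x : R, x \in `]c - h, c + h[ ->
    [/\ Pf x <= K, - K <= Pg x & delta <= Pf x - Pg x]) ->
  exists w z : R,
    [/\ 0 < w < 1, z \in `[c - h, c + h],
        w * g (c - h) + (1 - w) * g (c + h) = 0,
        w * f (c - h) + (1 - w) * f (c + h) = f z &
        1 / K * ln (1 + K * alpha (2 * h) K delta) <= z - c].
Proof.
move=> h0 K0 d0.
(* Only the distances of [c - h] and [c + h] to [c] matter from here on. *)
have : c + h - c = h by ring.
have : c - (c - h) = h by ring.
move: (c - h) (c + h) => a b ca bc cf cg fc gc Lfc Lgc f'' g'' sep.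
have Kn0 := lt0r_neq0 K0; pose A s := alpha (2 * s) K delta.
have [ac cb ab] : [/\ a < c, c < b & a < b] by split; lra.
have cab : c \in `]a, b[ by rewrite in_itv/= ac cb.
have f' t (tab : t \in `]a, b[) := (f'' t tab).1.
have Lf' t (tab : t \in `]a, b[) := (f'' t tab).2.
have g' t (tab : t \in `]a, b[) := (g'' t tab).1.
have Lg' t (tab : t \in `]a, b[) := (g'' t tab).2.
(* Integrated forms of the three bounds on [Pf] and [Pg]; they are used with
   [x = c] or [y = c]. *)
have Lincr x y : x \in `]a, b[ -> y \in `]a, b[ -> x <= y ->
    [/\ Lf y - Lf x <= K * (y - x), - K * (y - x) <= Lg y - Lg x &
        delta * (y - x) <= (Lf y - Lg y) - (Lf x - Lg x)].
  move=> xab yab xy.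
  have sub t (txy : t \in `]x, y[) : t \in `]a, b[.
    exact: in_itvoo_segment xab yab (subset_itv_oo_cc txy).
  have cLf := is_derive_within_continuous Lf' xab yab.
  have cLg := is_derive_within_continuous Lg' xab yab.
  split.
  - have NLf' t (txy : t \in `]x, y[) : is_derive t 1 (- Lf) (- Pf t) :=
      is_deriveN (Lf' t (sub t txy)).
    have cNLf : {within `[x, y], continuous (- Lf)}.
      by move=> t; exact: continuousN (cLf t).
    have : - K * (y - x) <= - Lf y - - Lf x.
      apply: (ge_derive_increment xy cNLf NLf') => t /sub /sep[+ _ _].
      by rewrite lerN2.
    lra.
  - apply: (ge_derive_increment xy cLg (fun t txy => Lg' t (sub t txy))).
    by move=> t /sub /sep[].
  - have D' t (txy : t \in `]x, y[) : is_derive t 1 (Lf - Lg) (Pf t - Pg t) :=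
      is_deriveB (Lf' t (sub t txy)) (Lg' t (sub t txy)).
    apply: (ge_derive_increment xy (within_continuousB cLf cLg) D').
    by move=> t /sub /sep[].
have sub_cb t (tcb : t \in `]c, b[) : t \in `]a, b[.
  by move: tcb; rewrite !in_itv/= => /andP[ct ->]; rewrite (lt_trans ac ct).
have sub_ac t (tac : t \in `]a, c[) : t \in `]a, b[.
  by move: tac; rewrite !in_itv/= => /andP[-> tc]; rewrite (lt_trans tc cb).
have S_cb : `[c, b] `<=` `[a, b].
  by move=> t /=; rewrite !in_itv/= => /andP[ct ->];
    rewrite (le_trans (ltW ac) ct).
have S_ac : `[a, c] `<=` `[a, b].
  by move=> t /=; rewrite !in_itv/= => /andP[-> tc];
    rewrite (le_trans tc (ltW cb)).
have dA (t : R) : is_derive t 1 (fun x => A (x - c))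
    (expR ((delta - K) * (t - c)) - expR (- K * (t - c))).
  exact: is_derive_subr (is_derive_alpha _ _ Kn0).
have dNA (t : R) : is_derive t 1 (fun x => - A (c - x))
    (expR ((delta - K) * (c - t)) - expR (- K * (c - t))).
  exact: is_derive_rsub (is_derive_alpha _ _ Kn0).
have right_gap : A h <= f b - g b.
  have A' t (tcb : t \in `]c, b[) : is_derive t 1 (fun x => A (x - c))
      (expR ((delta - K) * (t - c)) - expR (- K * (t - c))).
    exact: dA.
  have cA : {within `[c, b], continuous (fun x => A (x - c))}.
    by apply: derivable_within_continuous => t _; have [] := dA t.
  have D' t (tcb : t \in `]c, b[) :=
    is_deriveB (f' t (sub_cb t tcb)) (g' t (sub_cb t tcb)).
  have cD := within_continuousB (continuous_subspaceW S_cb cf)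
    (continuous_subspaceW S_cb cg).
  suff : A (b - c) - A (c - c) <= (f b - g b) - (f c - g c).
    by rewrite subrr /A mulr0 alpha0 bc fc gc !subr0.
  apply: (le_derive_increment (ltW cb) cA cD A' D') => t tcb.
  have ct : c <= t by move: tcb; rewrite in_itv/= => /andP[/ltW].
  have [_ HK Hd] := Lincr c t cab (sub_cb t tcb) ct.
  by apply: ler_expR_gap => //; lra.
(* To the left of [c] the roles are exchanged: there [f' <= g'], so that the
   smaller derivative, to be bounded below, is now [f']. *)
have left_gap : A h <= f a - g a.
  have A' t (tac : t \in `]a, c[) : is_derive t 1 (fun x => - A (c - x))
      (expR ((delta - K) * (c - t)) - expR (- K * (c - t))).
    exact: dNA.
  have cA : {within `[a, c], continuous (fun x => - A (c - x))}.
    by apply: derivable_within_continuous => t _; have [] := dNA t.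
  have D' t (tac : t \in `]a, c[) :=
    is_deriveB (g' t (sub_ac t tac)) (f' t (sub_ac t tac)).
  have cD := within_continuousB (continuous_subspaceW S_ac cg)
    (continuous_subspaceW S_ac cf).
  suff : - A (c - c) - - A (c - a) <= (g c - f c) - (g a - f a).
    by rewrite subrr /A mulr0 alpha0 ca fc gc subrr oppr0 !sub0r opprK opprB.
  apply: (le_derive_increment (ltW ac) cA cD A' D') => t tac.
  have tc : t <= c by move: tac; rewrite in_itv/= => /andP[_ /ltW].
  have [HK _ Hd] := Lincr t c (sub_ac t tac) cab tc.
  by apply: ler_expR_gap => //; lra.
have f_lt x y : a <= x -> x < y -> y <= b -> f x < f y.
  move=> ax xy yb.
  have Sxy : `[x, y] `<=` `[a, b].
    move=> t /=; rewrite !in_itv/= => /andP[xt ty].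
    by rewrite (le_trans ax xt) (le_trans ty yb).
  have sub t (txy : t \in `]x, y[) : t \in `]a, b[.
    move: txy; rewrite !in_itv/= => /andP[xt ty].
    by rewrite (le_lt_trans ax xt) (lt_le_trans ty yb).
  apply: (derive_gt0_lt xy (continuous_subspaceW Sxy cf)
    (fun t txy => f' t (sub t txy))).
  by move=> t _; exact: expR_gt0.
have ga : g a < 0.
  rewrite -gc; apply: (derive_gt0_lt ac (continuous_subspaceW S_ac cg)
    (fun t tac => g' t (sub_ac t tac))).
  by move=> t _; exact: expR_gt0.
have gb : 0 < g b.
  rewrite -gc; apply: (derive_gt0_lt cb (continuous_subspaceW S_cb cg)
    (fun t tcb => g' t (sub_cb t tcb))).
  by move=> t _; exact: expR_gt0.
have gba : 0 < g b - g a by lra.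
(* The weight for which the weighted value of [g] at the endpoints is
   [g c = 0]. *)
pose w := g b / (g b - g a).
have w01 : 0 < w < 1.
  by rewrite /w divr_gt0//= ltr_pdivrMr// mul1r; lra.
have wg : w * g a + (1 - w) * g b = 0.
  by rewrite /w; field; rewrite lt0r_neq0.
have /andP[w0 w1] := w01.
have fab := f_lt a b (lexx a) ab (lexx b).
set y := w * f a + (1 - w) * f b.
have yA : A h <= y.
  have e1 : w * (A h) <= w * (f a - g a) by rewrite ler_wpM2l// ltW.
  have e2 : (1 - w) * (A h) <= (1 - w) * (f b - g b).
    by rewrite ler_wpM2l// subr_ge0 ltW.
  by rewrite /y; nra.
have A0 : 0 <= A h by apply: alpha_ge0 => //; exact: ltW.
have [z zab fz] : exists2 z, z \in `[a, b] & f z = y.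
  apply: IVT cf _; first exact: ltW.
  rewrite (min_l (ltW fab)) (max_r (ltW fab)) /y; apply/andP; split; nra.
have [az zb] : a <= z /\ z <= b by move: zab; rewrite in_itv/= => /andP.
have cz : c <= z.
  rewrite leNgt; apply/negP => zc; have := f_lt z c az zc (ltW cb).
  by rewrite fc fz ltNge (le_trans A0 yA).
(* [Pf <= K] forces [f' t <= expR (K * (t - c))] to the right of [c]. *)
have fz_le : f z <= (expR (K * (z - c)) - 1) / K.
  pose E x := (expR (K * (x - c)) - 1) / K.
  have E' (t : R) : is_derive t 1 E (expR (K * (t - c))).
    exact: is_derive_subr (is_derive_expR_quot (t - c) Kn0).
  have cE : {within `[c, z], continuous E}.
    by apply: derivable_within_continuous => t _; have [] := E' t.
  have S_cz : `[c, z] `<=` `[a, b].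
    move=> t /=; rewrite !in_itv/= => /andP[ct tz].
    by rewrite (le_trans (ltW ac) ct) (le_trans tz zb).
  have sub t (tcz : t \in `]c, z[) : t \in `]a, b[.
    move: tcz; rewrite !in_itv/= => /andP[ct tz].
    by rewrite (lt_trans ac ct) (lt_le_trans tz zb).
  suff : f z - f c <= E z - E c.
    by rewrite fc subr0 /E subrr mulr0 expR0 subrr mul0r subr0.
  apply: (le_derive_increment cz (continuous_subspaceW S_cz cf) cE
    (fun t tcz => f' t (sub t tcz)) (fun t _ => E' t)) => t tcz.
  have ct : c <= t by move: tcz; rewrite in_itv/= => /andP[/ltW].
  have [HK _ _] := Lincr c t cab (sub t tcz) ct.
  by rewrite ler_expR; lra.
exists w, z; split => //.
rewrite -/(A h) mul1r mulrC ler_pdivrMr//.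
rewrite -ler_expR lnK ?posrE; last by have := mulr_ge0 (ltW K0) A0; lra.
rewrite [(z - c) * K]mulrC.
have : K * A h <= expR (K * (z - c)) - 1.
  rewrite mulrC -ler_pdivlMr//; lra.
lra.
Qed.

(** * Quasi-arithmetic means and their distance *)

Lemma qameanE (R : realType) (U : set R) (f : R -> R) (n : nat)
    (a w : 'I_n -> R) (z : R) :
  {in U &, injective f} -> U z -> \sum_(i < n) w i * f (a i) = f z ->
  qamean U f a w = z.
Proof. by move=> injf Uz; rewrite /qamean => ->; rewrite pinvKV// inE. Qed.

Lemma qadistC (R : realType) (U : set R) (f g : R -> R) :
  qadist U f g = qadist U g f.
Proof.
by congr ereal_sup; apply/seteqP; split=> d [n [a [w [Ua w0 w1 ->]]]];
  exists n, a, w; split=> //; rewrite distrC.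
Qed.

Lemma qadist_ge2 (R : realType) (U : set R) (f g : R -> R) (w x y u v : R) :
  {in U &, injective f} -> {in U &, injective g} ->
  U x -> U y -> U u -> U v -> 0 < w < 1 ->
  w * f x + (1 - w) * f y = f u -> w * g x + (1 - w) * g y = g v ->
  (`|u - v|%:E <= qadist U f g)%E.
Proof.
move=> injf injg Ux Uy Uu Uv /andP[w0 w1] fu gv.
pose p (i : 'I_2) := if i == ord0 then x else y.
pose q (i : 'I_2) := if i == ord0 then w else 1 - w.
have sumE (k : R -> R) : \sum_i q i * k (p i) = w * k x + (1 - w) * k y.
  by rewrite big_ord_recl big_ord1.
apply: ereal_sup_ubound; exists 2%N, p, q; split.
- by move=> i; rewrite /p; case: ifP.
- by move=> i; rewrite /q; case: ifP => // _; rewrite subr_gt0.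
- by rewrite big_ord_recl big_ord1 /q/= addrC subrK.
- by rewrite (qameanE (z := u))// ?sumE// (qameanE (z := v))// sumE.
Qed.

(** The mean of [g] is [c] and that of [f] is the [z] of [two_point_gap]; the
    affine normalization of [f] and [g] does not affect these means. *)
Lemma qadist_ge_ordered (R : realType) (U : set R) (K delta c h : R)
    (f g : R -> R) :
  is_interval U -> classS U f -> classS U g -> 0 < h ->
  `[c - h, c + h] `<=` U -> 0 < K -> 0 < delta ->
  (forall x : R, x \in `]c - h, c + h[ ->
    [/\ Pop U f x <= K, - K <= Pop U g x & delta <= Pop U f x - Pop U g x]) ->
  ((1 / K * ln (1 + K * alpha (2 * h) K delta))%:E <= qadist U f g)%E.
Proof.
move=> iU Sf Sg h0 hU K0 d0 sep.
have cI : c \in `]c - h, c + h[ by rewrite in_itv/= ltrBlDr !ltrDl h0.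
have endI t : t = c - h \/ t = c + h -> U t.
  by move=> tE; apply: hU; rewrite /= in_itv/=; case: tE => ->; lra.
have Uc : U c by apply: hU; exact: subset_itv_oo_cc cI.
have [kf [f1 [Lf [_ fE cf [fc Lfc] f']]]] := normalized_form Sf hU cI.
have [kg [g1 [Lg [_ gE cg [gc Lgc] g']]]] := normalized_form Sg hU cI.
have [w [z [w01 zI wg wf zc]]] :=
  two_point_gap h0 K0 d0 cf cg fc gc Lfc Lgc f' g' sep.
have fz : w * f (c - h) + (1 - w) * f (c + h) = f z.
  by rewrite (fE z) -wf (fE (c - h)) (fE (c + h)); ring.
have gz : w * g (c - h) + (1 - w) * g (c + h) = g c.
  rewrite -[RHS]add0r -(mulr0 kg) -wg (gE (c - h)) (gE (c + h)); ring.
apply: le_trans (qadist_ge2 (classS_inj iU Sf) (classS_inj iU Sg)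
  (endI _ (or_introl erefl)) (endI _ (or_intror erefl)) (hU _ zI) Uc w01 fz gz).
by rewrite lee_fin (le_trans zc)// ler_norm.
Qed.

(** * The lower bound *)

Theorem theorem2 (R : realType) (U : set R) (phi K delta : R) (f g : R -> R)
    (hU : nondegenerate_interval U)
    (hphi : 0 < phi) (hK : 0 < K) (hdelta : 0 < delta)
    (hf : classS U f) (hg : classS U g)
    (hsep : P_separated U phi K delta f g) :
  ((1 / K * ln (1 + K * alpha phi K delta))%:E <= qadist U f g)%E.
Proof.
have [iU _] := hU; have [a [b [ab phiE abU sep]]] := hsep.
have [c [h [aE bE]]] : exists c h, a = c - h /\ b = c + h.
  by exists ((a + b) / 2), ((b - a) / 2); split; field.
subst a b.
have {}phiE : phi = 2 * h by rewrite -phiE; ring.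
subst phi.
have h0 : 0 < h by lra.
have cI : c \in `]c - h, c + h[ by rewrite in_itv/= ltrBlDr !ltrDl h0.
have {}sep x : x \in `]c - h, c + h[ ->
    [/\ `|Pop U f x| <= K, `|Pop U g x| <= K &
        delta <= `|Pop U f x - Pop U g x|].
  by move=> /subset_itv_oo_cc; exact: sep.
have [kf [f1 [Lf [_ _ _ _ f']]]] := normalized_form hf abU cI.
have [kg [g1 [Lg [_ _ _ _ g']]]] := normalized_form hg abU cI.
(* [Pop U f - Pop U g] is the derivative of [Lf - Lg]. *)
have D' x (xI : x \in `]c - h, c + h[) :=
  is_deriveB (f' x xI).2 (g' x xI).2.
have D0 x : x \in `]c - h, c + h[ -> Pop U f x - Pop U g x != 0.
  by move=> /sep[_ _ dle]; rewrite -normr_gt0 (lt_le_trans hdelta).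
have [Dpos|Dneg] := derive_neq0_constant_sign D' D0; last rewrite qadistC.
- apply: (qadist_ge_ordered iU hf hg h0 abU hK hdelta) => x xI.
  have [/ler_normlP[_ PfK] /ler_normlP[PgK _]] := sep x xI.
  by rewrite gtr0_norm ?Dpos//; split => //; lra.
- apply: (qadist_ge_ordered iU hg hf h0 abU hK hdelta) => x xI.
  have [/ler_normlP[PfK _] /ler_normlP[_ PgK]] := sep x xI.
  by rewrite ltr0_norm ?Dneg//; split => //; lra.
Qed.
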